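(* Let $\{\rho_1,\ldots,\rho_r\}$ be a finite set of quantum states (density matrices) on a finite-dimensional complex Hilbert space $\mathcal{H}$. Then the asymptotic error exponent for testing $\{\rho_1^{\otimes n},\ldots,\rho_r^{\otimes n}\}$, for an arbitrary prior $\{p_1,\ldots,p_r\}$ (a probability distribution independent of $n$), is given by the multiple quantum Chernoff distance: $$\lim_{n\to\infty}\frac{-1}{n}\log P_e^*\left(\{p_1\rho_1^{\otimes n},\ldots,p_r\rho_r^{\otimes n}\}\right)=\min_{(i,j):\,i\neq j}\ \max_{0\le s\le 1}\left\{-\log \operatorname{Tr}\rho_i^s\rho_j^{1-s}\right\}.$$
   Context: A density matrix on $\mathcal{H}$ is a positive semidefinite operator of trace $1$. $\rho^{\otimes n}$ is the $n$-fold tensor power, a density matrix on $\mathcal{H}^{\otimes n}$. A POVM with $r$ outcomes on a finite-dimensional Hilbert space $\mathcal{K}$ is a tuple $\{M_1,\ldots,M_r\}$ of operators with $0\le M_i\le \mathbb{1}$ and $\sum_{i=1}^r M_i=\mathbb{1}$, where $\mathbb{1}$ is the identity. For positive semidefinite operators $A_1,\ldots,A_r$ on $\mathcal{K}$, the optimal error is $$P_e^*(\{A_1,\ldots,A_r\}):=\min\left\{\sum_{i=1}^r\operatorname{Tr}A_i(\mathbb{1}-M_i):\ \{M_1,\ldots,M_r\}\text{ a POVM on }\mathcal{K}\right\}.$$ When $A_i=p_i\omega_i$ with $\omega_i$ density matrices and $\{p_i\}$ a prior, this is the minimal average (Bayesian) error probability for identifying which of the states $\omega_1,\ldots,\omega_r$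 the system is in. The right-hand side of the identity is called the multiple quantum Chernoff distance of $\rho_1,\ldots,\rho_r$.
   Formalization: The prior is required to have every p_i > 0: with zero weights the identity fails, e.g. r = 2, p = (1,0), ρ_1 = ρ_2 gives P_e* = 0 and an infinite left side while the right side is 0. *)

(* Defs.v *)
(* The Hilbert space is C^d with C = R[i], R a realType;
   operators on it are d x d matrices over R[i]. *)
From mathcomp Require Export all_boot all_order all_algebra.
From mathcomp Require Export all_classical all_reals all_analysis.
From mathcomp Require Export sesquilinear spectral complex mxtens.

Set Implicit Arguments.
Unset Strict Implicit.
Unset Printing Implicit Defensive.
Import Order.TTheory GRing.Theory Num.Theory.
Import numFieldNormedType.Exports.
Local Open Scope complex_scope.
Local Open Scope classical_set_scope.
Local Open Scope ring_scope.

(* On R[i], 0 <= z means that z is real and nonnegative. *)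
Definition psdmx (R : realType) (d : nat) (A : 'M[R[i]]_d) : Prop :=
  A \is hermsymmx /\
  forall v : 'cV[R[i]]_d, 0 <= (map_mx Num.conj v^T *m A *m v) 0 0.

Definition density_matrix (R : realType) (d : nat) (rho : 'M[R[i]]_d) : Prop :=
  psdmx rho /\ \tr rho = 1.

Definition is_povm (R : realType) (d r : nat) (M : 'I_r -> 'M[R[i]]_d) : Prop :=
  (forall i, psdmx (M i) /\ psdmx (1%:M - M i)) /\ \sum_(i < r) M i = 1%:M.

Definition povm_error (R : realType) (d r : nat) (A M : 'I_r -> 'M[R[i]]_d) : R :=
  \sum_(i < r) complex.Re (\tr (A i *m (1%:M - M i))).

(* POVMs form a compact set on which povm_error is continuous (and bounded below
   by 0 when the A i are positive semidefinite), so this infimum is a minimum. *)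
Definition opt_error (R : realType) (d r : nat) (A : 'I_r -> 'M[R[i]]_d) : R :=
  inf [set povm_error A M | M in [set M | is_povm M]].

(* Real power with the convention 0^s = 0 for every s, including s = 0
   (the library's powR has 0 `^ 0 = 1). *)
Definition supp_pow (R : realType) (s x : R) : R :=
  if x == 0 then 0 else x `^ s.

(* rho^s by functional calculus on a unitary diagonalization of rho; powers are
   taken on the support of rho, so rho^0 is the projection onto the support. *)
Definition mxpow (R : realType) (d : nat) (rho : 'M[R[i]]_d) (s : R) :
    'M[R[i]]_d :=
  invmx (spectralmx rho) *m
  diag_mx (map_mx (fun z => (supp_pow s (complex.Re z))%:C) (spectral_diag rho)) *m
  spectralmx rho.

(* Values in \bar R, since - log 0 = +oo (states with orthogonal supports).  With
   the convention above, the trace is a continuous function of s on [0, 1] that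
   is either positive everywhere or identically 0, so the supremum is a maximum. *)
Definition chernoff_dist (R : realType) (d : nat) (rho sigma : 'M[R[i]]_d) :
    \bar R :=
  ereal_sup [set (- lne (complex.Re (\tr (mxpow rho s *m mxpow sigma (1 - s))))%:E)%E
            | s in [set s : R | 0 <= s <= 1]].

Definition multiple_chernoff_dist (R : realType) (d r : nat)
    (rho : 'I_r -> 'M[R[i]]_d) : \bar R :=
  \big[Order.min/+oo%E]_(ij : 'I_r * 'I_r | ij.1 != ij.2)
    chernoff_dist (rho ij.1) (rho ij.2).

(* Main.v *)
(* Achievability: let x_k run over the eigenvectors of all the A_i, listed by
   decreasing eigenvalue, and measure the rank-one projectors |x_k><x_k| one
   after the other, answering with the state to which the first hit belongs.  By
   the quantum union bound, an eigenvector x_k is misidentified with probability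
   at most four times the sum of |<x_l, x_k>|^2 over the l that precede k, and
   each of these has an eigenvalue at least that of x_k.  Hence the error is at
   most 4 sum_(i != j) sum_(a, b) min(lam_ia, lam_jb) |<x_ia, x_jb>|^2, and
   min(x, y) <= x^s y^(1-s) bounds this by the traces of the Chernoff distances.
   Converse (Nussbaum and Szkola): twice the error of any POVM is at least
   sum_(a, b) min(lam_ia, lam_jb) |<x_ia, x_jb>|^2 for every pair i != j.  For
   tensor powers this is a classical sum over words, which is evaluated by
   tilting at the minimizer of s |-> Tr rho_i^s rho_j^(1-s) and Chebyshev's
   inequality. *)
From mathcomp Require Import ring lra.
Require Import Defs.
Set Implicit Arguments.
Unset Strict Implicit.
Unset Printing Implicit Defensive.
Import Order.TTheory GRing.Theory Num.Theory.
Import numFieldNormedType.Exports.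
Local Open Scope complex_scope.
Local Open Scope classical_set_scope.
Local Open Scope ring_scope.

Local Notation adj A := (map_mx Num.conj A^T).

(** * Exponential sums and sums over words *)

(** From exp(-x) >= 1 - x one gets (1 - x) exp(x) <= 1, and (1 - x)(1 + x + 2x^2) = 1 + x^2 (1 - 2x)
    >= 1 for x <= 1/2. *)
Lemma expR_le_quad (R : realType) (x : R) :
  `|x| <= 2^-1 -> expR x <= 1 + x + 2 * x ^+ 2.
Proof.
move=> hx; have /andP[h1 h2] : -2^-1 <= x <= 2^-1 by rewrite -ler_norml.
have e := expR_ge1Dx (- x); rewrite expRN in e.
have h0 : 0 < expR x by exact: expR_gt0.
have : (1 - x) * expR x <= 1 by rewrite -ler_pdivlMr // mul1r.
nra.
Qed.

(* The conclusion is the sign of the right derivative at h = 0. *)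
Lemma sum_ge0_of_exp_min (R : realType) (T : finType) (c l : T -> R) (e : R) :
  (forall x, 0 <= c x) -> 0 < e ->
  (forall h : R, 0 < h <= e -> \sum_x c x <= \sum_x c x * expR (h * l x)) ->
  0 <= \sum_x c x * l x.
Proof.
move=> c0 e0 H; rewrite leNgt; apply/negP => m0.
set m := \sum_x _ in m0; pose V := \sum_x c x * l x ^+ 2.
pose L := \sum_x `|l x|.
have V0 : 0 <= V by apply: sumr_ge0 => x _; rewrite mulr_ge0 ?sqr_ge0.
have L0 : 0 <= L by apply: sumr_ge0.
have lL x : `|l x| <= L by rewrite /L (bigD1 x) //= lerDl sumr_ge0.
(* The three bounds on [h] make the hypothesis applicable, keep every [h * l x] within 1/2 for the
   quadratic estimate, and force h m + 2 h^2 V < 0. *)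
pose h := Num.min e (Num.min (2 * L + 1)^-1 (- m / (2 * V + 1) / 2)).
have h0 : 0 < h.
  rewrite !lt_min e0 invr_gt0 /= !divr_gt0 ?oppr_gt0 ?ltr_wpDl ?mulr_ge0 //.
have he : 0 < h <= e by rewrite h0 ge_min lexx.
have hL : h <= (2 * L + 1)^-1 by rewrite !ge_min lexx ?orbT.
have hm : h <= - m / (2 * V + 1) / 2 by rewrite !ge_min lexx ?orbT.
have hl x : `|h * l x| <= 2^-1.
  rewrite normrM (gtr0_norm h0).
  have D0 : 0 < 2 * L + 1 by rewrite ltr_wpDl ?mulr_ge0.
  have : h * (2 * L + 1) <= 1 by rewrite -ler_pdivlMr // mul1r.
  have := lL x; have := normr_ge0 (l x); nra.
have := H h he.
have : \sum_x c x * expR (h * l x) <= \sum_x c x + h * m + 2 * h ^+ 2 * V.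
  rewrite /m /V !mulr_sumr -!big_split /=; apply: ler_sum => x _.
  have := expR_le_quad (hl x); have := c0 x; nra.
have : h * (2 * V + 1) * 2 <= - m.
  rewrite -ler_pdivlMr // -ler_pdivlMr ?ltr_wpDl ?mulr_ge0 //.
  by rewrite mulrAC.
nra.
Qed.

(* m is the derivative of the exponential sum at its minimizer s: it vanishes in
   the interior, is >= 0 at s = 0 and <= 0 at s = 1. *)
Lemma exp_sum_minimizer (R : realType) (T : finType) (c l : T -> R) :
  (forall x, 0 <= c x) ->
  exists2 s : R, 0 <= s <= 1 &
    let m := \sum_x c x * expR (s * l x) * l x in
    s * m <= 0 /\ 0 <= (1 - s) * m.
Proof.
move=> c0; pose Z (s : R) := \sum_x c x * expR (s * l x).
have cZ : continuous Z.
  rewrite /Z => s; elim: (index_enum T) => [|x e IH].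
    by under eq_fun do rewrite big_nil; exact: cvg_cst.
  under eq_fun do rewrite big_cons; apply: cvgD => //.
  apply: cvgM; first exact: cvg_cst.
  apply: continuous_cvg; first exact: continuous_expR.
  by apply: cvgM; [exact: cvg_id | exact: cvg_cst].
have [|s] := @EVT_min R Z 0 1 ler01; first exact: continuous_subspaceT.
rewrite in_itv /= => /andP[s0 s1] smin.
exists s; first by rewrite s0.
rewrite /=; set m := \sum_x _.
have pos x : 0 <= c x * expR (s * l x) by rewrite mulr_ge0 ?expR_ge0.
have up : s < 1 -> 0 <= m.
  rewrite -subr_gt0 => s1'.
  apply: (@sum_ge0_of_exp_min _ _ _ _ (1 - s)) => // h /andP[h0 h1].
  have /smin : s + h \in `[0, 1] by rewrite in_itv /=; lra.
  rewrite /Z; under [X in _ <= X -> _]eq_bigr => x _ do rewrite mulrDl expRD mulrA.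
  by [].
have dn : 0 < s -> m <= 0.
  move=> s0'; rewrite -oppr_ge0 -sumrN.
  under eq_bigr => x _ do rewrite -mulrN.
  apply: (@sum_ge0_of_exp_min _ _ _ _ s) => // h /andP[h0 h1].
  have /smin : s - h \in `[0, 1] by rewrite in_itv /=; lra.
  rewrite /Z; under [X in _ <= X -> _]eq_bigr => x _ do
    rewrite mulrBl expRD mulrA -mulrN.
  by [].
split.
  have [->|sn] := eqVneq s 0; first by rewrite mul0r.
  by rewrite mulr_ge0_le0 // dn // lt_neqAle eq_sym sn.
have [->|sn] := eqVneq s 1; first by rewrite subrr mul0r.
by rewrite mulr_ge0 ?subr_ge0 // up // lt_neqAle sn.
Qed.

(** Letters are peeled off one at a time, as a tensor power peels off its first factor; [ntens_sum]
    matches the two recursions. *)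
Fixpoint wsum (R : nmodType) (T : finType) n (F : seq T -> R) : R :=
  if n is n'.+1 then \sum_x wsum n' (fun w => F (x :: w)) else F [::].

Section WordSum.
Variables (R : realType) (T : finType).
Implicit Types (F G : seq T -> R) (f g h : T -> R).

Lemma wsumS n F : wsum n.+1 F = \sum_x wsum n (fun w => F (x :: w)).
Proof. by []. Qed.

Lemma eq_wsum n F G : F =1 G -> wsum n F = wsum n G.
Proof.
elim: n F G => [|n IH] F G FG /=; first exact: FG.
by apply: eq_bigr => x _; apply: IH => w; exact: FG.
Qed.

Lemma ler_wsum n F G :
  (forall w, size w = n -> F w <= G w) -> wsum n F <= wsum n G.
Proof.
elim: n F G => [|n IH] F G FG /=; first exact: FG.
by apply: ler_sum => x _; apply: IH => w wn; apply: FG; rewrite /= wn.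
Qed.

Lemma wsumZ n a F : wsum n (fun w => a * F w) = a * wsum n F.
Proof.
elim: n F => [|n IH] F //=; rewrite mulr_sumr.
by apply: eq_bigr => x _; rewrite IH.
Qed.

Lemma wsumD n F G : wsum n (fun w => F w + G w) = wsum n F + wsum n G.
Proof.
elim: n F G => [|n IH] F G //=; rewrite -big_split /=.
by apply: eq_bigr => x _; rewrite IH.
Qed.

Lemma wsum_prod n f : wsum n (fun w => \prod_(x <- w) f x) = (\sum_x f x) ^+ n.
Proof.
elim: n => [|n IH] /=; first by rewrite big_nil.
under eq_bigr => x _.
  under eq_wsum => w do rewrite big_cons.
  rewrite wsumZ IH; over.
by rewrite -mulr_suml exprS.
Qed.

Lemma wsum_first_moment n f h :
  \sum_x f x = 1 -> \sum_x f x * h x = 0 ->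
  wsum n (fun w => (\prod_(x <- w) f x) * \sum_(x <- w) h x) = 0.
Proof.
move=> f1 fh; elim: n => [|n IH] /=; first by rewrite !big_nil mulr0.
under eq_bigr => x _.
  under eq_wsum => w do rewrite !big_cons mulrDr mulrAC -[f x * _ * _]mulrA.
  rewrite wsumD !wsumZ IH mulr0 addr0 wsum_prod f1 expr1n mulr1; over.
exact: fh.
Qed.

(** Variance of a sum of independent centred variables: the cross term of (h x + S)^2 vanishes by
    [wsum_first_moment]. *)
Lemma wsum_second_moment n f h :
  \sum_x f x = 1 -> \sum_x f x * h x = 0 ->
  wsum n (fun w => (\prod_(x <- w) f x) * (\sum_(x <- w) h x) ^+ 2) =
  n%:R * \sum_x f x * h x ^+ 2.
Proof.
move=> f1 fh; elim: n => [|n IH] /=.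
  by rewrite !big_nil expr0n /= mulr0 mul0r.
under eq_bigr => x _.
  under eq_wsum => w.
    rewrite !big_cons sqrrD -mulrnAr.
    rewrite (_ : _ * _ = (f x * h x ^+ 2) * \prod_(x <- w) f x +
       ((f x * h x *+ 2) * ((\prod_(x <- w) f x) * \sum_(x <- w) h x) +
        f x * ((\prod_(x <- w) f x) * (\sum_(x <- w) h x) ^+ 2))); last by ring.
  over.
  rewrite !wsumD !wsumZ wsum_prod f1 expr1n mulr1 wsum_first_moment // mulr0 add0r IH.
  over.
by rewrite big_split /= -mulr_suml f1 mul1r -[n.+1]addn1 natrD mulrDl mul1r addrC.
Qed.

End WordSum.

(** * Powers on the support *)

Section SuppPow.
Variable R : realType.
Implicit Types s x y : R.

Lemma supp_pow_ge0 s x : 0 <= supp_pow s x.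
Proof. by rewrite /supp_pow; case: ifP => // _; exact: powR_ge0. Qed.

Lemma supp_powM s x y : 0 <= x -> 0 <= y ->
  supp_pow s (x * y) = supp_pow s x * supp_pow s y.
Proof.
move=> x0 y0; rewrite /supp_pow mulf_eq0.
case: eqVneq => [->|xn]; first by rewrite /= mul0r.
by case: eqVneq => [->|yn] /=; rewrite ?mulr0 // powRM.
Qed.

Lemma supp_pow_prod (T : Type) s (f : T -> R) (w : seq T) : (forall t, 0 <= f t) ->
  supp_pow s (\prod_(t <- w) f t) = \prod_(t <- w) supp_pow s (f t).
Proof.
move=> f0; elim: w => [|x w IH].
  by rewrite !big_nil /supp_pow oner_eq0 powR1.
by rewrite !big_cons supp_powM ?IH // prodr_ge0.
Qed.

Lemma supp_powE s x : 0 < x -> supp_pow s x = expR (s * ln x).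
Proof. by move=> x0; rewrite /supp_pow gt_eqF // /powR gt_eqF. Qed.

(** On a logarithmic scale the right-hand side is a convex combination of ln x and ln y; if x or y
    is 0, the minimum is at most 0. *)
Lemma min_le_supp_pow s x y : 0 <= s <= 1 -> 0 <= x -> 0 <= y ->
  Num.min x y <= supp_pow s x * supp_pow (1 - s) y.
Proof.
move=> /andP[s0 s1]; rewrite le_eqVlt => /predU1P[<-|x0].
  by rewrite ge_min mulr_ge0 ?supp_pow_ge0.
rewrite le_eqVlt => /predU1P[<-|y0].
  by rewrite ge_min mulr_ge0 ?supp_pow_ge0 ?orbT.
rewrite !supp_powE // -expRD.
have [xy|yx] := leP x y.
  rewrite -{1}[x]lnK ?posrE // ler_expR.
  have : ln x <= ln y by rewrite ler_ln ?posrE.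
  nra.
rewrite -{1}[y]lnK ?posrE // ler_expR.
have : ln y < ln x by rewrite ltr_ln ?posrE.
nra.
Qed.

End SuppPow.

Lemma prod_expR_ln (R : realType) (T : eqType) (f : T -> R) (w : seq T) :
  (forall x, x \in w -> 0 < f x) ->
  \prod_(x <- w) f x = expR (\sum_(x <- w) ln (f x)).
Proof.
move=> f0; rewrite expR_sum !big_seq; apply: eq_bigr => x xw.
by rewrite lnK // posrE f0.
Qed.

(** Divided by [Z], the weight [q] is the tilted law on letters. Under its product law the
    log-likelihood ratio of a word has mean n m / Z, and Chebyshev's inequality bounds its deviation
    from there, with [V] the variance of [l]. *)
Lemma wsum_min_ge (R : realType) (T : finType) (a b v : T -> R) (s : R)
    (q := fun x => supp_pow s (a x) * supp_pow (1 - s) (b x) * v x)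
    (l := fun x => ln (a x) - ln (b x)) (Z := \sum_x q x) (m := \sum_x q x * l x) :
  (forall x, 0 <= a x) -> (forall x, 0 <= b x) -> (forall x, 0 <= v x) ->
  0 <= s <= 1 -> 0 < Z -> s * m <= 0 -> 0 <= (1 - s) * m ->
  exists V : R, forall n e, (0 < n)%N -> 0 < e ->
    Z ^+ n * expR (- (n%:R * e)) * (1 - V / (n%:R * e ^+ 2)) <=
    wsum n (fun w => Num.min (\prod_(x <- w) a x) (\prod_(x <- w) b x) *
                     \prod_(x <- w) v x).
Proof.
move=> a0 b0 v0 /andP[s0 s1] Z0 m1 m2.
have Zn : Z != 0 by rewrite gt_eqF.
pose f x := q x / Z; pose mu := m / Z; pose h x := l x - mu.
have f1 : \sum_x f x = 1 by rewrite -mulr_suml divff.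
have fh : \sum_x f x * h x = 0.
  under eq_bigr do rewrite mulrBr; rewrite sumrB -mulr_suml f1 mul1r.
  under eq_bigr do rewrite /f mulrAC; by rewrite -mulr_suml subrr.
exists (\sum_x f x * h x ^+ 2) => n e n0 e0.
have nR : 0 < n%:R :> R by rewrite ltr0n.
have mu1 : s * mu <= 0 by rewrite mulrA pmulr_lle0 // invr_gt0.
have mu2 : 0 <= (1 - s) * mu by rewrite mulrA pmulr_lge0 // invr_gt0.
have f0 x : 0 <= f x by rewrite !mulr_ge0 ?supp_pow_ge0 ?invr_ge0 ?(ltW Z0).
have -> : Z ^+ n * expR (- (n%:R * e)) * (1 - (\sum_x f x * h x ^+ 2) / (n%:R * e ^+ 2))
   = wsum n (fun w => Z ^+ n * expR (- (n%:R * e)) * (\prod_(x <- w) f x +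
       (- (n%:R * e) ^- 2) * ((\prod_(x <- w) f x) * (\sum_(x <- w) h x) ^+ 2))).
  rewrite wsumZ wsumD wsumZ wsum_prod f1 expr1n wsum_second_moment //.
  congr (_ * (1 + _)); rewrite mulNr; congr (- _).
  by field; rewrite !gt_eqF.
(* Chebyshev without indicator functions: the factor 1 - (S / (n e))^2 is at most
   1 where |S| <= n e and negative elsewhere. *)
apply: ler_wsum => w wn.
have qE : Z ^+ n * \prod_(x <- w) f x = \prod_(x <- w) q x.
  rewrite /f big_split /= big_const_seq count_predT wn iter_mulr_1 exprVn.
  by rewrite mulrCA mulfV ?mulr1 // expf_neq0.
set S := \sum_(x <- w) h x; set P := \prod_(x <- w) f x in qE *.
have -> : Z ^+ n * expR (- (n%:R * e)) * (P + - (n%:R * e) ^- 2 * (P * S ^+ 2)) =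
  (\prod_(x <- w) q x) * expR (- (n%:R * e)) * (1 - S ^+ 2 / (n%:R * e) ^+ 2).
  by rewrite -qE; field; rewrite !gt_eqF.
have rhs0 : 0 <= Num.min (\prod_(x <- w) a x) (\prod_(x <- w) b x) * \prod_(x <- w) v x.
  by rewrite mulr_ge0 ?le_min ?prodr_ge0.
have q0 x : 0 <= q x by rewrite !mulr_ge0 ?supp_pow_ge0.
(* A word of weight 0 makes the left side vanish; in any other word all letters have positive [a]
   and [b], so that the logarithms are genuine. *)
have [Q0|Q0] := eqVneq (\prod_(x <- w) q x) 0; first by rewrite Q0 !mul0r.
have ab x : x \in w -> 0 < a x /\ 0 < b x.
  move=> xw; have : q x != 0.
    apply: contraNneq Q0 => qx; rewrite prodf_seq_eq0; apply/hasP.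
    by exists x => //=; rewrite ?qx ?eqxx.
  rewrite /q !mulf_eq0 !negb_or /supp_pow => /andP[/andP[+ +] _].
  have [->|na] := eqVneq (a x) 0; first by rewrite eqxx.
  have [->|nb] := eqVneq (b x) 0; first by rewrite eqxx.
  by rewrite !lt0r na nb a0 b0.
rewrite (@prod_expR_ln _ _ a) ?(@prod_expR_ln _ _ b); try by move=> x /ab[].
set A := \sum_(x <- w) _; set B := \sum_(x <- w) _; set W := \prod_(x <- w) v x in rhs0 *.
have W0 : 0 <= W by rewrite prodr_ge0.
have -> : \prod_(x <- w) q x = expR (s * A + (1 - s) * B) * W.
  rewrite /q !big_split /= -!supp_pow_prod //
    (@prod_expR_ln _ _ a) ?(@prod_expR_ln _ _ b);
    try by move=> x /ab[].
  by rewrite !supp_powE ?expR_gt0 // !expRK -expRD.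
have -> : S = A - B - n%:R * mu.
  rewrite /S /h sumrB big_split /= sumrN big_const_seq count_predT wn.
  by rewrite iter_addr_0 mulr_natl.
set t := A - B - _.
have t2 : 0 <= t ^+ 2 / (n%:R * e) ^+ 2 by rewrite mulr_ge0 ?invr_ge0 ?sqr_ge0.
have ne0 : 0 < n%:R * e by rewrite mulr_gt0.
have E0 : 0 <= expR (s * A + (1 - s) * B) * W * expR (- (n%:R * e)).
  by rewrite !mulr_ge0 ?expR_ge0.
have [tn|tn] := leP `|t| (n%:R * e); last first.
  apply: le_trans (mulr_ge0 _ W0); last by rewrite le_min !expR_ge0.
  rewrite mulr_ge0_le0 // subr_le0 ler_pdivlMr ?exprn_gt0 // mul1r.
  by rewrite -[t ^+ 2]real_normK ?num_real // ler_pXn2r ?nnegrE // ltW.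
apply: (@le_trans _ _ (expR (s * A + (1 - s) * B) * W * expR (- (n%:R * e)))).
  by rewrite ler_piMr // gerBl.
(* With D = A - B = n mu + t, the exponents A and B differ from s A + (1 - s) B by (1 - s) D and - s
   D. The signs of s mu and (1 - s) mu and |t| <= n e make both at least - n e. *)
rewrite mulrAC; apply: ler_wpM2r => //; rewrite -expRD le_min !ler_expR.
move: tn; rewrite ler_norml /t => /andP[t1' t2'].
have := ltW nR; set k := n%:R in nR ne0 t1' t2' *; move=> k0.
have k1 : k * (s * mu) <= 0 by nra.
have k2 : 0 <= k * ((1 - s) * mu) by nra.
by apply/andP; split; nra.
Qed.

(** * Sequential rank-one measurements *)

Section Matrices.
Variable R : realType.
Local Notation C := R[i].

Definition nsq (z : C) : R := complex.Re z ^+ 2 + complex.Im z ^+ 2.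

Lemma nsqE z : (nsq z)%:C = z * Num.conj z.
Proof. by rewrite add_Re2_Im2 normCK. Qed.

Lemma nsq_ge0 z : 0 <= nsq z.
Proof. by rewrite addr_ge0 ?sqr_ge0. Qed.

Lemma nsq_conj z : nsq (Num.conj z) = nsq z.
Proof. by case: z => a b; rewrite /nsq /= sqrrN. Qed.

Lemma nsqM z t : nsq (z * t) = nsq z * nsq t.
Proof. by case: z t => [a b] [c e]; rewrite /nsq /=; ring. Qed.

Lemma nsq0 : nsq 0 = 0.
Proof. by rewrite /nsq /= expr0n addr0. Qed.

Lemma nsqD_le z t : nsq (z + t) <= 2 * (nsq z + nsq t).
Proof.
case: z t => [a b] [c e]; rewrite /nsq /=.
have := sqr_ge0 (a - c); have := sqr_ge0 (b - e); nra.
Qed.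

(** Cauchy-Schwarz for two terms, in a form suited to induction: the cross term x = Re(z conj(t))
    satisfies x^2 <= (e1 d1)(e2 d2), hence 2x <= e1 d2 + e2 d1. *)
Lemma nsqD_le_mul z t e1 e2 d1 d2 :
  0 <= e1 -> 0 <= e2 -> 0 <= d1 -> 0 <= d2 ->
  nsq z <= e1 * d1 -> nsq t <= e2 * d2 -> nsq (z + t) <= (e1 + e2) * (d1 + d2).
Proof.
case: z t => [a b] [c e]; rewrite /nsq /= => e10 e20 d10 d20 h1 h2.
set x := a * c + b * e.
have x2 : x ^+ 2 <= (a ^+ 2 + b ^+ 2) * (c ^+ 2 + e ^+ 2).
  by rewrite /x; have := sqr_ge0 (a * e - b * c); nra.
have x2' : x ^+ 2 <= (e1 * d1) * (e2 * d2).
  by apply: le_trans x2 _; rewrite ler_pM ?addr_ge0 ?sqr_ge0.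
have : x * 2 <= e1 * d2 + e2 * d1.
  apply: le_trans (ler_norm _) _.
  have p0 : 0 <= e1 * d2 + e2 * d1 by rewrite addr_ge0 ?mulr_ge0.
  rewrite -(ler_pXn2r (n := 2)) ?nnegrE // real_normK ?num_real //.
  have := sqr_ge0 (e1 * d2 - e2 * d1); nra.
rewrite /x; nra.
Qed.

Lemma adjM m n p (A : 'M[C]_(m, n)) (B : 'M[C]_(n, p)) :
  adj (A *m B) = adj B *m adj A.
Proof. by rewrite trmx_mul map_mxM. Qed.

Lemma adjK m n (A : 'M[C]_(m, n)) : adj (adj A) = A.
Proof. exact: trmxCK. Qed.

Lemma adjD m n (A B : 'M[C]_(m, n)) : adj (A + B) = adj A + adj B.
Proof. by apply/matrixP => i j; rewrite !mxE rmorphD. Qed.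

Lemma adjB m n (A B : 'M[C]_(m, n)) : adj (A - B) = adj A - adj B.
Proof. by apply/matrixP => i j; rewrite !mxE rmorphB. Qed.

Lemma adj1 n : adj (1%:M : 'M[C]_n) = 1%:M.
Proof. by rewrite trmx1 map_mx1. Qed.

(** Vectors are rows and matrices act on them from the right. For a unit vector x, [rank1 x] is the
    projector onto x and [defl x] the complementary projection. *)
Definition ip n (u v : 'rV[C]_n) : C := (u *m adj v) 0 0.
Definition nrm2 n (u : 'rV[C]_n) : R := \sum_j nsq (u 0 j).
Definition qf n (A : 'M[C]_n) (u : 'rV[C]_n) : C := (u *m A *m adj u) 0 0.
Definition rank1 n (x : 'rV[C]_n) : 'M[C]_n := adj x *m x.
Definition defl n (x u : 'rV[C]_n) : 'rV[C]_n := u - ip u x *: x.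

Section InnerProduct.
Variable n : nat.
Implicit Types (u v w x : 'rV[C]_n) (A B : 'M[C]_n).

Lemma ip_conj u v : ip v u = Num.conj (ip u v).
Proof.
have -> : Num.conj (ip u v) = (adj (u *m adj v)) 0 0.
  by rewrite [RHS]mxE [X in _ = Num.conj X]mxE.
by rewrite adjM adjK.
Qed.

Lemma ipBl u v w : ip (u - v) w = ip u w - ip v w.
Proof. by rewrite /ip mulmxBl !mxE. Qed.

Lemma ipDl u v w : ip (u + v) w = ip u w + ip v w.
Proof. by rewrite /ip mulmxDl mxE. Qed.

Lemma ipZl a u w : ip (a *: u) w = a * ip u w.
Proof. by rewrite /ip -scalemxAl mxE. Qed.

Lemma ipBr u v w : ip w (u - v) = ip w u - ip w v.
Proof. by rewrite ![ip w _]ip_conj ipBl rmorphB. Qed.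

Lemma ipZr a u w : ip w (a *: u) = Num.conj a * ip w u.
Proof. by rewrite ![ip w _]ip_conj ipZl rmorphM. Qed.

Lemma ipxx u : ip u u = (nrm2 u)%:C.
Proof.
rewrite /nrm2 /ip !mxE rmorph_sum; apply: eq_bigr => j _.
by rewrite !mxE; exact: esym (nsqE _).
Qed.

Lemma nrm2_ge0 u : 0 <= nrm2 u.
Proof. by apply: sumr_ge0 => j _; exact: nsq_ge0. Qed.

Lemma nsq_ipC u v : nsq (ip v u) = nsq (ip u v).
Proof. by rewrite ip_conj nsq_conj. Qed.

Lemma mul_rank1 u x : u *m rank1 x = ip u x *: x.
Proof. by rewrite mulmxA [u *m _]mx11_scalar mul_scalar_mx. Qed.

Lemma mul_1B_rank1 u x : u *m (1%:M - rank1 x) = defl x u.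
Proof. by rewrite mulmxBr mulmx1 mul_rank1. Qed.

Lemma adj_rank1 x : adj (rank1 x) = rank1 x.
Proof. by rewrite adjM adjK. Qed.

Lemma qfD A B u : qf (A + B) u = qf A u + qf B u.
Proof. by rewrite /qf mulmxDr mulmxDl mxE. Qed.

Lemma qfB A B u : qf (A - B) u = qf A u - qf B u.
Proof. by rewrite /qf mulmxBr mulmxBl !mxE. Qed.

Lemma qf1 u : qf 1%:M u = (nrm2 u)%:C.
Proof. by rewrite /qf mulmx1 -ipxx. Qed.

Lemma qf0 u : qf 0 u = 0.
Proof. by rewrite /qf mulmx0 mul0mx mxE. Qed.

Lemma qf_rank1 x u : qf (rank1 x) u = (nsq (ip u x))%:C.
Proof. by rewrite /qf mul_rank1 -[LHS]/(ip _ _) ipZl [ip x u]ip_conj nsqE. Qed.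

Lemma qf_congr A B u : qf (B *m A *m adj B) u = qf A (u *m B).
Proof. by rewrite /qf adjM !mulmxA. Qed.

Lemma nrm2_defl x u : ip x x = 1 -> nrm2 (defl x u) = nrm2 u - nsq (ip u x).
Proof.
move=> x1; apply: complexI; rewrite rmorphB /= nsqE -!ipxx /defl.
by rewrite ipBl !ipBr !ipZl !ipZr x1 [ip x u]ip_conj; ring.
Qed.

Lemma defl_defl x u : ip x x = 1 -> defl x (defl x u) = defl x u.
Proof.
by move=> x1; rewrite /defl ipBl ipZl x1 mulr1 subrr scale0r subr0.
Qed.

Lemma rank1_idem x : ip x x = 1 -> (1%:M - rank1 x) *m (1%:M - rank1 x) = 1%:M - rank1 x.
Proof.
move=> x1; apply/row_matrixP => i; rewrite !rowE mulmxA !mul_1B_rank1.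
exact: defl_defl.
Qed.

Lemma psdmxP A : psdmx A <-> adj A = A /\ forall u, 0 <= qf A u.
Proof.
split=> [[/is_hermitianmxP hA pA]|[hA pA]].
  split=> [|u]; first by rewrite {2}hA expr0 scale1r.
  by have := pA (adj u); rewrite adjK.
split=> [|v]; first by apply/is_hermitianmxP; rewrite expr0 scale1r.
by have := pA (adj v); rewrite /qf adjK.
Qed.

Lemma psdmx0 : psdmx (0 : 'M[C]_n).
Proof. by apply/psdmxP; split=> [|u]; rewrite ?qf0 // trmx0 map_mx0. Qed.

Lemma psdmx1 : psdmx (1%:M : 'M[C]_n).
Proof. by apply/psdmxP; split=> [|u]; rewrite ?adj1 // qf1 ler0c nrm2_ge0. Qed.

Lemma psdmxD A B : psdmx A -> psdmx B -> psdmx (A + B).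
Proof.
move=> /psdmxP[hA pA] /psdmxP[hB pB]; apply/psdmxP; split=> [|u].
  by rewrite adjD hA hB.
by rewrite qfD addr_ge0.
Qed.

Lemma psdmx_congr A B : psdmx A -> psdmx (B *m A *m adj B).
Proof.
move=> /psdmxP[hA pA]; apply/psdmxP; split=> [|u]; last by rewrite qf_congr.
by rewrite !adjM adjK hA mulmxA.
Qed.

Lemma psdmx_rank1 x : psdmx (rank1 x).
Proof.
by apply/psdmxP; split=> [|u]; rewrite ?adj_rank1 // qf_rank1 ler0c nsq_ge0.
Qed.

Lemma psdmx_sum (I : Type) (r : seq I) (P : pred I) (F : I -> 'M[C]_n) :
  (forall i, P i -> psdmx (F i)) -> psdmx (\sum_(i <- r | P i) F i).
Proof. by move=> h; apply: big_ind; [exact: psdmx0 | exact: psdmxD |]. Qed.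

End InnerProduct.

Section SequentialMeasurement.
Variables (n r : nat) (K : eqType) (X : K -> 'rV[C]_n) (lab : K -> 'I_r) (i0 : 'I_r).
Hypothesis X1 : forall a, ip (X a) (X a) = 1.

(** The unnormalized vector left when none of the projectors listed in [s] has responded. *)
Definition deflate (u : 'rV[C]_n) (s : seq K) : 'rV[C]_n :=
  foldl (fun v a => defl (X a) v) u s.

Lemma nrm2_deflate u s : nrm2 (deflate u s) <= nrm2 u.
Proof.
elim: s u => [|a s IH] u //=; apply: le_trans (IH _) _.
by rewrite nrm2_defl // gerBl nsq_ge0.
Qed.

(* Each deflation step moves u by <u, x_a> x_a and lowers its squared norm by
   |<u, x_a>|^2; the bound is Cauchy-Schwarz over the steps. *)
Lemma deflate_drift u v s :
  nsq (ip (u - deflate u s) v) <=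
  (\sum_(a <- s) nsq (ip v (X a))) * (nrm2 u - nrm2 (deflate u s)).
Proof.
elim: s u => [|a s IH] u /=.
  by rewrite big_nil mul0r subrr /ip mul0mx mxE nsq0.
set u' := defl (X a) u; rewrite big_cons.
have -> : u - deflate u' s = ip u (X a) *: X a + (u' - deflate u' s).
  by rewrite /u' /defl addrA addrCA subrr addr0.
have -> : nrm2 u - nrm2 (deflate u' s) =
    nsq (ip u (X a)) + (nrm2 u' - nrm2 (deflate u' s)).
  by rewrite /u' nrm2_defl //; ring.
rewrite ipDl ipZl; apply: nsqD_le_mul; rewrite ?nsq_ge0 //.
- by apply: sumr_ge0 => b _; exact: nsq_ge0.
- by rewrite subr_ge0 nrm2_deflate.
- by rewrite nsqM (nsq_ipC (X a) v) mulrC.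
Qed.

(** For z = <deflate v s, v>, [deflate_drift] gives |1 - z|^2 <= e (1 - |z|^2). With x = Re z this
    yields 1 - x <= e (1 + x) <= 2e, and then 1 - |z|^2 <= (1 - x)(1 + x) <= 4e. *)
Lemma quantum_union_bound v s : ip v v = 1 ->
  1 - nsq (ip (deflate v s) v) <= 4 * \sum_(a <- s) nsq (ip v (X a)).
Proof.
move=> v1; set e := \sum_(a <- s) _.
have e0 : 0 <= e by apply: sumr_ge0 => a _; exact: nsq_ge0.
have nv : nrm2 v = 1 by apply: complexI; rewrite -ipxx v1.
have := deflate_drift v v s; rewrite ipBl v1 nv -/e.
set z := ip _ v; have zle : nsq z <= nrm2 (deflate v s).
  by rewrite -subr_ge0 -nrm2_defl // nrm2_ge0.
move=> h; have {h} : nsq (1 - z) <= e * (1 - nsq z).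
  by apply: le_trans h _; rewrite ler_wpM2l // lerD2l lerN2.
have : nsq z <= 1 by apply: le_trans zle _; rewrite -nv nrm2_deflate.
case: z zle => x y _; rewrite /nsq /= => z1 h.
(* For e >= 1 the claim is trivial, its left side being at most 1. *)
have [ge1|lt1] := leP 1 e; first by have := sqr_ge0 x; have := sqr_ge0 y; lra.
have xx : (1 - x) ^+ 2 <= e * (1 - x ^+ 2).
  by have := sqr_ge0 y; nra.
have x1 : x <= 1 by have := sqr_ge0 y; nra.
have y2 := sqr_ge0 y.
have [->|xn] := eqVneq x 1; first by nra.
have xlt : 0 < 1 - x by rewrite subr_gt0 lt_neqAle xn.
have : 1 - x <= e * (1 + x) by rewrite -(ler_pM2l xlt); lra.
nra.
Qed.

(* If no projector of the list responds, the answer is i0. *)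
Fixpoint seq_povm (s : seq K) (i : 'I_r) : 'M[C]_n :=
  if s is a :: s' then
    (if lab a == i then rank1 (X a) else 0) +
    (1%:M - rank1 (X a)) *m seq_povm s' i *m (1%:M - rank1 (X a))
  else if i == i0 then 1%:M else 0.

Lemma seq_povm_psd s i : psdmx (seq_povm s i).
Proof.
elim: s => [|a s IH] /=; first by case: ifP => _; [exact: psdmx1|exact: psdmx0].
apply: psdmxD; first by case: ifP => _; [exact: psdmx_rank1|exact: psdmx0].
have {2}<- : adj (1%:M - rank1 (X a)) = 1%:M - rank1 (X a).
  by rewrite adjB adj1 adj_rank1.
exact: psdmx_congr.
Qed.

Lemma seq_povm_sum s : \sum_i seq_povm s i = 1%:M.
Proof.
elim: s => [|a s IH] /=.
  by rewrite -big_mkcond /= big_pred1_eq.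
rewrite big_split /= -mulmx_suml -mulmx_sumr IH mulmx1 rank1_idem //.
rewrite -big_mkcond /= (eq_bigl (pred1 (lab a))) ?big_pred1_eq 1?addrC ?subrK //.
Qed.

Lemma is_povm_of_sum (M : 'I_r -> 'M[C]_n) :
  (forall i, psdmx (M i)) -> \sum_i M i = 1%:M -> is_povm M.
Proof.
move=> pM sM; split=> // i; split=> //.
rewrite -sM (bigD1 i) //= addrAC subrr add0r.
by apply: psdmx_sum.
Qed.

(** The answer [lab a] is given in particular when all of [s] stay silent and [a] then responds;
    every other branch adds a nonnegative term. *)
Lemma qf_seq_povm s t a u :
  (nsq (ip (deflate u s) (X a)))%:C <= qf (seq_povm (s ++ a :: t) (lab a)) u.
Proof.
have hrank x : adj (1%:M - rank1 x) = 1%:M - rank1 x :> 'M[C]_n.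
  by rewrite adjB adj1 adj_rank1.
have step b i M u' : qf (M + (1%:M - rank1 (X b)) *m seq_povm i (lab a) *m
    (1%:M - rank1 (X b))) u' = qf M u' + qf (seq_povm i (lab a)) (defl (X b) u').
  by rewrite qfD -{2}hrank qf_congr mul_1B_rank1.
have qpos s' u' : 0 <= qf (seq_povm s' (lab a)) u'.
  by have /psdmxP[_] := seq_povm_psd s' (lab a); exact.
elim: s u => [|b s IH] u /=; rewrite step.
  by rewrite eqxx qf_rank1 lerDl.
apply: le_trans (IH _) _; rewrite lerDr.
by case: ifP => _; rewrite ?qf0 // qf_rank1 ler0c nsq_ge0.
Qed.

End SequentialMeasurement.
End Matrices.

(** * Error bounds for diagonalized states and their tensor powers *)

Section Diagonalization.
Variable R : realType.
Local Notation C := R[i].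

(** For unitary [U], the rows of [U] are eigenvectors with eigenvalues [f]. *)
Definition udiag n (U : 'M[C]_n) (f : 'I_n -> R) : 'M[C]_n :=
  adj U *m diag_mx (\row_a (f a)%:C) *m U.

Definition overlap n (U V : 'M[C]_n) (a b : 'I_n) : R := nsq ((U *m adj V) a b).

Lemma overlap_ge0 n (U V : 'M[C]_n) a b : 0 <= overlap U V a b.
Proof. exact: nsq_ge0. Qed.

Lemma ip_row n (U V : 'M[C]_n) a b : ip (row a U) (row b V) = (U *m adj V) a b.
Proof. by rewrite /ip !mxE; apply: eq_bigr => j _; rewrite !mxE. Qed.

Lemma ip_row_unitary n (U : 'M[C]_n) a b : U \is unitarymx ->
  ip (row a U) (row b U) = (a == b)%:R.
Proof. by move=> /unitarymxP uU; rewrite ip_row uU mxE. Qed.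

Lemma unitarymx_adjM n (U : 'M[C]_n) : U \is unitarymx -> adj U *m U = 1%:M.
Proof. by move=> /unitarymxP /mulmx1C. Qed.

Lemma qf_row n (U B : 'M[C]_n) a : qf B (row a U) = (U *m B *m adj U) a a.
Proof. by rewrite /qf -row_mul !mxE; apply: eq_bigr => j _; rewrite !mxE. Qed.

Lemma mxtrace_udiagM n (U B : 'M[C]_n) f :
  \tr (udiag U f *m B) = \sum_a (f a)%:C * qf B (row a U).
Proof.
rewrite /udiag -!mulmxA mxtrace_mulC -!mulmxA; apply: eq_bigr => a _.
by rewrite qf_row mul_diag_mx mxE [X in X * _ = _]mxE mulmxA.
Qed.

Lemma qf_udiag n (V : 'M[C]_n) g (u : 'rV[C]_n) :
  qf (udiag V g) u = \sum_b (g b)%:C * (nsq (ip u (row b V)))%:C.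
Proof.
rewrite /udiag /qf !mulmxA -!mulmxA.
have -> : V *m adj u = adj (u *m adj V) by rewrite adjM adjK.
rewrite mulmxA mul_diag_mx mxE; apply: eq_bigr => b _.
have -> : ip u (row b V) = (u *m adj V) 0 b.
  by rewrite /ip !mxE; apply: eq_bigr => j _; rewrite !mxE.
move: (u *m adj V) => w; rewrite nsqE mxE [X in _ * (X * _) = _]mxE.
by rewrite mulrCA [X in _ * (_ * X) = _]mxE [X in _ * (_ * Num.conj X) = _]mxE.
Qed.

Lemma udiag1 n (V : 'M[C]_n) : V \is unitarymx -> udiag V (fun=> 1) = 1%:M.
Proof.
move=> uV; rewrite /udiag -[RHS](unitarymx_adjM uV); congr (_ *m _).
rewrite -[RHS]mulmx1; congr (_ *m _).
by apply/matrixP => i j; rewrite !mxE.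
Qed.

(** Parseval's identity, obtained from the quadratic form of the identity matrix diagonalized by
    [V]. *)
Lemma nrm2_unitary n (V : 'M[C]_n) (u : 'rV[C]_n) : V \is unitarymx ->
  nrm2 u = \sum_b nsq (ip u (row b V)).
Proof.
move=> uV; apply: complexI; rewrite -qf1 -(udiag1 uV) qf_udiag.
by rewrite rmorph_sum /=; apply: eq_bigr => b _; rewrite mul1r.
Qed.

Lemma mxtrace_udiag_udiag n (U V : 'M[C]_n) f g :
  \tr (udiag U f *m udiag V g) =
  (\sum_a \sum_b f a * g b * overlap U V a b)%:C.
Proof.
rewrite mxtrace_udiagM rmorph_sum; apply: eq_bigr => a _.
rewrite qf_udiag mulr_sumr rmorph_sum; apply: eq_bigr => b _.
by rewrite ip_row !rmorphM /= mulrA.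
Qed.

(** Each spectral value is the quadratic form of [A] at a row of [P], hence real and nonnegative, so
    that taking real parts loses nothing. *)
Lemma psdmx_spectral n (A : 'M[C]_n) (P := spectralmx A)
    (f := fun a => complex.Re (spectral_diag A 0 a)) : psdmx A ->
  A = udiag P f /\ forall a, 0 <= f a.
Proof.
move=> pA; have [hA _] := pA; have /psdmxP[_ qA] := pA.
have uP : P \is unitarymx := spectral_unitarymx A.
have /orthomx_spectralP := hermitian_normalmx hA; rewrite -/P invmx_unitary // => EA.
have sA a : spectral_diag A 0 a = qf A (row a P).
  by rewrite qf_row {2}EA !mulmxA (unitarymxP uP) mul1mx
    -mulmxA (unitarymxP uP) mulmx1 mxE eqxx.
have f0 a : spectral_diag A 0 a = (f a)%:C.
  by rewrite RRe_real // sA ger0_real.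
split=> [|a]; last by rewrite -ler0c -f0 sA.
have E : spectral_diag A = \row_a (f a)%:C.
  by apply/rowP => a; rewrite mxE -f0.
by rewrite /udiag -E.
Qed.

Lemma map_mx_row n (h : C -> C) (D : 'rV[C]_n) : map_mx h D = \row_a h (D 0 a).
Proof. by apply/rowP => a; rewrite !mxE. Qed.

Lemma mxpow_udiag n (A : 'M[C]_n) s :
  mxpow A s = udiag (spectralmx A)
    (fun a => supp_pow s (complex.Re (spectral_diag A 0 a))).
Proof.
rewrite /mxpow (invmx_unitary (spectral_unitarymx A)) /udiag.
by rewrite map_mx_row.
Qed.

Lemma udiagZ n (U : 'M[C]_n) f c : c%:C *: udiag U f = udiag U (fun a => c * f a).
Proof.
have E : diag_mx (\row_a (c * f a)%:C) = c%:C *: diag_mx (\row_a (f a)%:C).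
  by rewrite -linearZ /=; congr diag_mx; apply/rowP => a; rewrite !mxE rmorphM.
by rewrite /udiag E -scalemxAr -scalemxAl.
Qed.

Lemma Re_ge0 (z : C) : 0 <= z -> 0 <= complex.Re z.
Proof. by rewrite lecE => /andP[]. Qed.

Lemma ReB (z t : C) : complex.Re (z - t) = complex.Re z - complex.Re t.
Proof. by case: z t => [a b] [c e]. Qed.

Lemma qf_psd_Re_ge0 n (A : 'M[C]_n) u : psdmx A -> 0 <= complex.Re (qf A u).
Proof. by move=> /psdmxP[_ /(_ u)]; exact: Re_ge0. Qed.

(* T >= T^2 because T - T^2 = T (1 - T) T + (1 - T) T (1 - T). *)
Lemma nrm2_mul_le n (T : 'M[C]_n) u : psdmx T -> psdmx (1%:M - T) ->
  nrm2 (u *m T) <= complex.Re (qf T u).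
Proof.
move=> pT pT'; have [aT _] := (psdmxP _).1 pT; have [aT' _] := (psdmxP _).1 pT'.
have := qf_psd_Re_ge0 u (psdmxD (psdmx_congr T pT') (psdmx_congr (1%:M - T) pT)).
rewrite aT aT'.
have -> : T *m (1%:M - T) *m T + (1%:M - T) *m T *m (1%:M - T) = T - T *m T.
  rewrite !(mulmxBl, mulmxBr, mul1mx, mulmx1).
  move: (T *m T *m T) (T *m T) => P Q.
  by apply/matrixP => a b; rewrite !mxE; ring.
have -> : qf (T - T *m T) u = qf T u - (nrm2 (u *m T))%:C.
  by rewrite qfB -ipxx /ip adjM aT /qf !mulmxA.
by rewrite ReB subr_ge0.
Qed.

(** Splitting x_a = x_a (1 - T) + x_a T bounds each overlap by two squares. The minimum is replaced
    by f a on the first and by g b on the second; Parseval's identity sums them, and [nrm2_mul_le]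
    returns to the quadratic forms. *)
Lemma two_outcome_lower n (U V T : 'M[C]_n) (f g : 'I_n -> R) :
  U \is unitarymx -> V \is unitarymx ->
  (forall a, 0 <= f a) -> (forall b, 0 <= g b) ->
  psdmx T -> psdmx (1%:M - T) ->
  \sum_a \sum_b Num.min (f a) (g b) * overlap U V a b <=
  2 * (\sum_a f a * complex.Re (qf (1%:M - T) (row a U)) +
       \sum_b g b * complex.Re (qf T (row b V))).
Proof.
move=> uU uV f0 g0 pT pT'; have [aT _] := (psdmxP _).1 pT.
have pT'' : psdmx (1%:M - (1%:M - T)) by rewrite subKr.
pose x a := row a U; pose y b := row b V.
have ov a b : overlap U V a b <=
    2 * (nsq (ip (x a *m (1%:M - T)) (y b)) + nsq (ip (y b *m T) (x a))).
  have -> : nsq (ip (y b *m T) (x a)) = nsq (ip (x a *m T) (y b)).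
    rewrite ip_conj nsq_conj; congr nsq.
    by rewrite /ip adjM aT mulmxA.
  rewrite /overlap -ip_row; apply: le_trans (nsqD_le _ _).
  by rewrite -ipDl -mulmxDr subrK mulmx1.
have sx : \sum_a \sum_b f a * nsq (ip (x a *m (1%:M - T)) (y b)) <=
    \sum_a f a * complex.Re (qf (1%:M - T) (x a)).
  apply: ler_sum => a _; rewrite -mulr_sumr -(nrm2_unitary _ uV).
  by apply: ler_wpM2l; [exact: f0 | exact: nrm2_mul_le].
have sy : \sum_a \sum_b g b * nsq (ip (y b *m T) (x a)) <=
    \sum_b g b * complex.Re (qf T (y b)).
  rewrite exchange_big; apply: ler_sum => b _; rewrite -mulr_sumr -(nrm2_unitary _ uU).
  by apply: ler_wpM2l; [exact: g0 | exact: nrm2_mul_le].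
apply: le_trans (ler_wpM2l (ler0n _ 2) (lerD sx sy)).
rewrite -big_split mulr_sumr /=; apply: ler_sum => a _.
rewrite -big_split mulr_sumr /=; apply: ler_sum => b _.
have m0 : 0 <= Num.min (f a) (g b) by rewrite le_min f0 g0.
apply: le_trans (ler_wpM2l m0 (ov a b)) _.
rewrite mulrCA; apply: ler_wpM2l; first exact: ler0n.
rewrite mulrDr; apply: lerD; apply: ler_wpM2r; rewrite ?nsq_ge0 //.
  by rewrite ge_min lexx.
by rewrite ge_min lexx orbT.
Qed.

Lemma povm_pair_psd n r (M : 'I_r -> 'M[C]_n) (i j : 'I_r) :
  is_povm M -> i != j -> psdmx (1%:M - M j - M i).
Proof.
move=> [pM sM] ij; rewrite -sM (bigD1 i) //= (bigD1 j) /=; last by rewrite eq_sym.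
have -> (X Y Z : 'M[C]_n) : X + (Y + Z) - Y - X = Z.
  by apply/matrixP => a b; rewrite !mxE; ring.
by apply: psdmx_sum => k _; exact: (pM k).1.
Qed.

(** * Bounds on the optimal error of diagonalized operators *)

Section OptError.
Variables (n r : nat) (U : 'I_r -> 'M[C]_n) (lam : 'I_r -> 'I_n -> R).
Hypothesis uU : forall i, U i \is unitarymx.
Hypothesis lam0 : forall i a, 0 <= lam i a.

Let state i := udiag (U i) (lam i).

Lemma povm_errorE M : povm_error state M =
  \sum_i \sum_a lam i a * complex.Re (qf (1%:M - M i) (row a (U i))).
Proof.
apply: eq_bigr => i _; rewrite mxtrace_udiagM.
rewrite (raddf_sum (@complex.Re R : Rcomplex R -> R)); apply: eq_bigr => a _.
by case: (qf _ _) => x y /=; rewrite mul0r subr0.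
Qed.

Lemma povm_error_ge0 M : is_povm M -> 0 <= povm_error state M.
Proof.
move=> [pM _]; rewrite povm_errorE; apply: sumr_ge0 => i _; apply: sumr_ge0 => a _.
by rewrite mulr_ge0 // qf_psd_Re_ge0 //; have [] := pM i.
Qed.

Lemma opt_error_le_povm M : is_povm M -> opt_error state <= povm_error state M.
Proof.
move=> pM; apply: ge_inf; last by exists M.
by exists 0 => _ [N pN <-]; exact: povm_error_ge0.
Qed.

Lemma opt_error_upper (i0 : 'I_r) :
  opt_error state <= 4 * \sum_i \sum_(j | j != i)
    \sum_a \sum_b Num.min (lam i a) (lam j b) * overlap (U i) (U j) a b.
Proof.
pose X (k : 'I_r * 'I_n) := row k.2 (U k.1).
pose l (k : 'I_r * 'I_n) := lam k.1 k.2.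
have X1 k : ip (X k) (X k) = 1 by rewrite ip_row_unitary // eqxx.
pose ge_l := fun k k' => l k' <= l k.
pose s := sort ge_l (index_enum _).
have ss : sorted ge_l s by apply: sort_sorted => k k'; exact: le_total.
have us : uniq s by rewrite sort_uniq index_enum_uniq.
have ms k : k \in s by rewrite mem_sort mem_index_enum.
pose M := seq_povm X fst i0 s.
have pM : is_povm M.
  by apply: is_povm_of_sum; [exact: seq_povm_psd | exact: seq_povm_sum].
apply: le_trans (opt_error_le_povm pM) _.
(* Pairs from the same state can be left out, because the eigenvectors of one state are
   orthonormal. *)
pose G (k k' : 'I_r * 'I_n) :=
  if k'.1 != k.1 then Num.min (l k) (l k') * nsq (ip (X k) (X k')) else 0.
have G0 k k' : 0 <= G k k'.
  by rewrite /G; case: ifP => // _; rewrite mulr_ge0 ?nsq_ge0 ?le_min ?lam0.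
have key k : l k * complex.Re (qf (1%:M - M k.1) (X k)) <= 4 * \sum_k' G k k'.
  have [s1 [s2 Es]] : exists s1 s2, s = s1 ++ k :: s2.
    by case/splitPr: (ms k) => s1 s2; exists s1, s2.
  have lb : nsq (ip (deflate X (X k) s1) (X k)) <= complex.Re (qf (M k.1) (X k)).
    have := @qf_seq_povm _ _ _ _ X fst i0 s1 s2 k (X k).
    by rewrite -Es lecE => /andP[].
  have -> : complex.Re (qf (1%:M - M k.1) (X k)) = 1 - complex.Re (qf (M k.1) (X k)).
    by rewrite qfB qf1 -ipxx X1 ReB.
  apply: (@le_trans _ _ (l k * (4 * \sum_(k' <- s1) nsq (ip (X k) (X k'))))).
    rewrite ler_wpM2l ?lam0 //; apply: le_trans (quantum_union_bound X1 s1 (X1 k)).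
    by rewrite lerD2l lerN2.
  rewrite mulrCA ler_pM2l // mulr_sumr.
  have -> : \sum_k' G k k' = \sum_(k' <- s) G k k'.
    by apply: perm_big; rewrite perm_sym perm_sort.
  (* Entries from k onwards only enlarge the right side; for an entry k' before k the sorting gives
     l k <= l k', so the minimum in [G] is l k. *)
  rewrite Es big_cat /= -[leLHS]addr0; apply: lerD; last by apply: sumr_ge0.
  rewrite big_seq [leRHS]big_seq; apply: ler_sum => k' k's1.
  have kk' : k' != k.
    apply: contraTneq k's1 => ->; apply/negP => ks1.
    by move: us; rewrite Es cat_uniq /= ks1 /= andbF.
  have lkk' : l k <= l k'.
    have tr : transitive ge_l by move=> x y z h1 h2; exact: le_trans h2 h1.
    move: ss; rewrite Es sorted_cat_cons // => /andP[s1s _].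
    move: s1s; rewrite -cats1 sorted_pairwise // pairwise_cat.
    by case/and3P => /allrelP/(_ _ _ k's1 (mem_head _ _)).
  rewrite /G; case: eqP => [e|_] /=.
    have -> : ip (X k) (X k') = 0.
      rewrite /X e ip_row_unitary //; case: eqP => // e2; move: kk'.
      by rewrite -pair_eqE /= e e2 !eqxx.
    by rewrite nsq0 mulr0.
  by rewrite (min_idPl lkk').
rewrite povm_errorE !pair_big /= -/l.
apply: le_trans (_ : _ <= \sum_k 4 * \sum_k' G k k') _.
  by apply: ler_sum => k _; exact: key.
rewrite -mulr_sumr ler_pM2l // le_eqVlt; apply/orP; left; apply/eqP.
transitivity (\sum_i \sum_a \sum_(j | j != i) \sum_b
   Num.min (lam i a) (lam j b) * overlap (U i) (U j) a b).
  rewrite [RHS]pair_big /=; apply: eq_bigr => k _.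
  rewrite /G -big_mkcond /= pair_big_dep /=; apply: eq_big => [k'|k' _].
    by rewrite andbT.
  by rewrite ip_row.
by apply: eq_bigr => i _; rewrite exchange_big.
Qed.

Lemma opt_error_lower (i j : 'I_r) : i != j ->
  \sum_a \sum_b Num.min (lam i a) (lam j b) * overlap (U i) (U j) a b <=
  2 * opt_error state.
Proof.
move=> ij; rewrite mulrC -ler_pdivrMr //; apply: lb_le_inf.
  (* The infimum is over a nonempty set: the measurement that always answers i is a POVM. *)
  exists (povm_error state (fun k => if k == i then 1%:M else 0)).
  exists (fun k => if k == i then 1%:M else 0) => //.
  apply: is_povm_of_sum => [k|]; last by rewrite -big_mkcond /= big_pred1_eq.
  by case: ifP => _; [exact: psdmx1|exact: psdmx0].
move=> _ [M [pM sM] <-]; rewrite ler_pdivrMr // mulrC.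
(* The test is T = M i. Of the error only the terms of i and j are kept, and M i <= 1 - M j turns
   the second error of the test into that of j. *)
have := two_outcome_lower (uU i) (uU j) (lam0 i) (lam0 j) (pM i).1 (pM i).2.
move/le_trans; apply; apply: ler_wpM2l; first exact: ler0n.
rewrite povm_errorE (bigD1 i) //= lerD2l (bigD1 j) /=; last by rewrite eq_sym.
rewrite -[leLHS]addr0; apply: lerD; last first.
  apply: sumr_ge0 => k _; apply: sumr_ge0 => a _.
  by apply: mulr_ge0; [exact: lam0 | apply: qf_psd_Re_ge0; exact: (pM k).2].
apply: ler_sum => b _; apply: ler_wpM2l; first exact: lam0.
rewrite -subr_ge0 -ReB -qfB; apply: qf_psd_Re_ge0.
by apply: povm_pair_psd.
Qed.

End OptError.

(** * Tensor products and tensor powers of diagonalized matrices *)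

Lemma adj_tens m n p q (A : 'M[C]_(m, n)) (B : 'M[C]_(p, q)) :
  adj (tensmx A B) = tensmx (adj A) (adj B).
Proof. by rewrite trmx_tens map_mxT. Qed.

Lemma mxtens_index_eq m n (i i' : 'I_m) (j j' : 'I_n) :
  (mxtens_index (i, j) == mxtens_index (i', j')) = (i == i') && (j == j').
Proof. by rewrite (can_eq (@mxtens_indexK m n)). Qed.

Lemma tens_diag_mx m n (f : 'rV[C]_m) (g : 'rV[C]_n) :
  tensmx (diag_mx f) (diag_mx g) =
  diag_mx (\row_k (f 0 (mxtens_unindex k).1 * g 0 (mxtens_unindex k).2)).
Proof.
apply/matrixP => k l; case: (mxtens_indexP k) => i i'; case: (mxtens_indexP l) => j j'.
rewrite tensmxE !mxE mxtens_indexK mxtens_index_eq /=.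
by case: eqP => _; case: eqP => _; rewrite ?mulr1n ?mulr0n ?mulr0 ?mul0r.
Qed.

Lemma tens1mx1 m n : tensmx 1%:M 1%:M = 1%:M :> 'M[C]_(m * n).
Proof.
apply/matrixP => k l; case: (mxtens_indexP k) => i i'; case: (mxtens_indexP l) => j j'.
rewrite tensmxE !mxE mxtens_index_eq.
by case: eqP => _; case: eqP => _; rewrite ?mulr1 ?mulr0.
Qed.

Lemma tens_unitarymx m n (U : 'M[C]_m) (V : 'M[C]_n) :
  U \is unitarymx -> V \is unitarymx -> tensmx U V \is unitarymx.
Proof.
move=> /unitarymxP uU /unitarymxP uV; apply/unitarymxP.
by rewrite adj_tens tensmx_mul uU uV tens1mx1.
Qed.

Lemma tens_udiag m n (U : 'M[C]_m) (V : 'M[C]_n) f g :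
  tensmx (udiag U f) (udiag V g) =
  udiag (tensmx U V) (fun k => f (mxtens_unindex k).1 * g (mxtens_unindex k).2).
Proof.
rewrite /udiag -!tensmx_mul -adj_tens tens_diag_mx.
have -> // : (\row_k ((\row_a (f a)%:C) 0 (mxtens_unindex k).1 *
    (\row_a (g a)%:C) 0 (mxtens_unindex k).2)) =
  \row_k (f (mxtens_unindex k).1 * g (mxtens_unindex k).2)%:C.
by apply/rowP => k; rewrite !mxE rmorphM.
Qed.

Lemma overlap_tens m n (U U' : 'M[C]_m) (V V' : 'M[C]_n) a a' b b' :
  overlap (tensmx U V) (tensmx U' V') (mxtens_index (a, b)) (mxtens_index (a', b')) =
  overlap U U' a a' * overlap V V' b b'.
Proof. by rewrite /overlap adj_tens tensmx_mul tensmxE nsqM. Qed.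

Lemma sum_mxtens m n (V : nmodType) (F : 'I_(m * n) -> V) :
  \sum_k F k = \sum_i \sum_j F (mxtens_index (i, j)).
Proof.
rewrite pair_big /= (reindex (@mxtens_index m n)) /=.
  by apply: eq_bigr => -[].
by exists (@mxtens_unindex m n) => k _; rewrite ?mxtens_indexK ?mxtens_unindexK.
Qed.

(* [ntensmx A k.+1] is [ntensmx_rec A k], hence the shift in the exponent. *)
Fixpoint ntens_eig n (f : 'I_n -> R) k : 'I_(n ^ k.+1) -> R :=
  if k is k'.+1 then
    fun a => f (mxtens_unindex a).1 * @ntens_eig n f k' (mxtens_unindex a).2
  else f.

Lemma ntens_eigS n (f : 'I_n -> R) k a b :
  @ntens_eig n f k.+1 (mxtens_index (a, b)) = f a * @ntens_eig n f k b.
Proof.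
pose ab := mxtens_unindex (@mxtens_index n (n ^ k.+1) (a, b)).
by rewrite -[LHS]/(f ab.1 * @ntens_eig n f k ab.2) /ab mxtens_indexK.
Qed.

Lemma ntens_eig_ge0 n (f : 'I_n -> R) k a :
  (forall i, 0 <= f i) -> 0 <= @ntens_eig n f k a.
Proof. by move=> f0; elim: k a => [|k IH] a //=; rewrite mulr_ge0. Qed.

Lemma ntens_unitarymx n (U : 'M[C]_n) k :
  U \is unitarymx -> ntensmx_rec U k \is unitarymx.
Proof. by move=> uU; elim: k => [|k IH] //=; exact: tens_unitarymx. Qed.

Lemma ntens_udiag n (U : 'M[C]_n) f k :
  ntensmx_rec (udiag U f) k = udiag (ntensmx_rec U k) (@ntens_eig n f k).
Proof. by elim: k => [|k IH] //=; rewrite IH tens_udiag. Qed.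

(** A word of pairs lists the eigenvector indices of both sides factor by factor. [F] is arbitrary
    so that the induction can absorb the first letter into it. *)
Lemma ntens_sum n (U V : 'M[C]_n) f g k (F : R -> R -> R -> R) :
  \sum_a \sum_b F (@ntens_eig n f k a) (@ntens_eig n g k b)
                  (overlap (ntensmx_rec U k) (ntensmx_rec V k) a b) =
  wsum k.+1 (fun w : seq ('I_n * 'I_n) =>
    F (\prod_(x <- w) f x.1) (\prod_(x <- w) g x.2)
      (\prod_(x <- w) overlap U V x.1 x.2)).
Proof.
elim: k F => [|k IH] F.
  rewrite /= pair_big /=; apply: eq_bigr => x _.
  by rewrite !big_cons !big_nil !mulr1.
transitivity (\sum_a \sum_b wsum k.+1 (fun w =>
   F (\prod_(x <- (a, b) :: w) f x.1) (\prod_(x <- (a, b) :: w) g x.2)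
      (\prod_(x <- (a, b) :: w) overlap U V x.1 x.2))); last first.
  by rewrite pair_bigA [RHS]wsumS; apply: eq_bigr => -[].
rewrite sum_mxtens; apply: eq_bigr => a _.
under eq_bigr => a' _ do rewrite sum_mxtens.
rewrite exchange_big; apply: eq_bigr => b _.
transitivity (\sum_a' \sum_b' F (f a * @ntens_eig n f k a') (g b * @ntens_eig n g k b')
   (overlap U V a b * overlap (ntensmx_rec U k) (ntensmx_rec V k) a' b')).
  apply: eq_bigr => a' _; apply: eq_bigr => b' _.
  by rewrite -!ntens_eigS -overlap_tens.
rewrite (IH (fun x y z => F (f a * x) (g b * y) (overlap U V a b * z))).
by apply: eq_wsum => w; rewrite !big_cons.
Qed.

End Diagonalization.

(** * Asymptotics *)

(** On letters where a and b are both positive, the summand of Z is b v exp(s l) with l = ln a - ln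
    b; elsewhere it is 0 for every s. So Z is an exponential sum, and its minimizer on [0, 1] has
    the signs that [wsum_min_ge] asks for. *)
Lemma chernoff_tilt (R : realType) (T : finType) (a b v : T -> R)
    (Z := fun s => \sum_x supp_pow s (a x) * supp_pow (1 - s) (b x) * v x) :
  (forall x, 0 <= a x) -> (forall x, 0 <= b x) -> (forall x, 0 <= v x) ->
  exists2 s : R, 0 <= s <= 1 & 0 < Z s ->
  exists V : R, forall n e, (0 < n)%N -> 0 < e ->
    Z s ^+ n * expR (- (n%:R * e)) * (1 - V / (n%:R * e ^+ 2)) <=
    wsum n (fun w => Num.min (\prod_(x <- w) a x) (\prod_(x <- w) b x) *
                     \prod_(x <- w) v x).
Proof.
move=> a0 b0 v0.
pose l x := ln (a x) - ln (b x).
pose c x := if (a x == 0) || (b x == 0) then 0 else b x * v x.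
have c0 x : 0 <= c x by rewrite /c; case: ifP => // _; rewrite mulr_ge0.
have [s s01 [m1 m2]] := exp_sum_minimizer l c0.
exists s => // Z0.
have cE x : c x * expR (s * l x) = supp_pow s (a x) * supp_pow (1 - s) (b x) * v x.
  rewrite /c; have [ax|ax] := eqVneq (a x) 0.
    by rewrite ax /supp_pow eqxx !mul0r.
  have [bx|bx] := eqVneq (b x) 0.
    by rewrite bx /supp_pow eqxx mulr0 !mul0r.
  rewrite /= !supp_powE ?lt0r ?ax ?bx ?a0 ?b0 // -expRD.
  rewrite -{1}[b x]lnK ?posrE ?lt0r ?bx ?b0 // mulrAC -expRD /l.
  by congr (expR _ * _); ring.
have mE : \sum_x c x * expR (s * l x) * l x =
    \sum_x supp_pow s (a x) * supp_pow (1 - s) (b x) * v x * (ln (a x) - ln (b x)).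
  by apply: eq_bigr => x _; rewrite cE.
rewrite mE in m1 m2.
exact: wsum_min_ge.
Qed.

(** Treats finite and infinite limits alike: only real thresholds c strictly on one side of [M]
    occur, and the slack e leaves room for constants. *)
Lemma cvge_slack (R : realType) (f : nat -> \bar R) (M : \bar R) :
  (forall c e : R, 0 < e -> (c%:E < M)%E -> \forall n \near \oo, ((c - e)%:E <= f n)%E) ->
  (forall c e : R, 0 < e -> (M < c%:E)%E -> \forall n \near \oo, (f n <= (c + e)%:E)%E) ->
  f @ \oo --> M.
Proof.
case: M => [r| |] lo up.
- have bd e : 0 < e -> \forall n \near \oo, ((r - e)%:E <= f n <= (r + e)%:E)%E.
    move=> e0; have e20 : 0 < e / 2 by rewrite divr_gt0.
    have h1 := lo (r - e / 2) _ e20; have h2 := up (r + e / 2) _ e20.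
    have {}h1 := h1 _; have {}h2 := h2 _.
    have l1 : ((r - e / 2)%:E < r%:E)%E by rewrite lte_fin ltrBlDr ltrDl.
    have l2 : (r%:E < (r + e / 2)%:E)%E by rewrite lte_fin ltrDl.
    have := h1 l1; have := h2 l2.
    rewrite (_ : r - e / 2 - e / 2 = r - e); last by field.
    rewrite (_ : r + e / 2 + e / 2 = r + e); last by field.
    by move=> u2 u1; near=> n; apply/andP; split; near: n.
  apply/fine_cvgP; split.
    have := bd _ (ltr01 : 0 < 1 :> R); apply: filterS => n /andP[h1 h2].
    by rewrite fin_numE; case: (f n) h1 h2.
  apply/cvgrPdist_le => e e0; have := bd _ e0; apply: filterS => n /andP[].
  rewrite /comp; case: (f n) => //= x; rewrite !lee_fin ler_norml => h1 h2.
  by apply/andP; split; lra.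
- apply/cvgeyPge => A; have := lo (A + 1) 1 ltr01 (ltry _).
  by rewrite addrK.
- apply/cvgeNyPle => A; have := up (A - 1) 1 ltr01 (ltNyr _).
  by rewrite subrK.
Unshelve. all: by end_near. Qed.

Lemma exponent_ge (R : realType) (E a : R) n : (0 < n)%N ->
  E <= expR (- (a * n%:R)) -> (a%:E <= (- 1 / n%:R)%:E * lne E%:E)%E.
Proof.
move=> n0 h; have nR : 0 < n%:R :> R by rewrite ltr0n.
(* Here [lne] is -oo, so the exponent is +oo. *)
have [E0|E0] := leP E 0.
  rewrite le0_lneNy ?lee_fin // lt0_muleNy ?leey // lte_fin mulN1r oppr_lt0.
  by rewrite invr_gt0.
rewrite lne_EFin // -EFinM lee_fin mulN1r mulNr lerNr mulrC.
rewrite ler_pdivrMr // -ler_expR lnK ?posrE //.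
by rewrite mulNr.
Qed.

Lemma exponent_le (R : realType) (E a : R) n : (0 < n)%N ->
  expR (- (a * n%:R)) <= E -> ((- 1 / n%:R)%:E * lne E%:E <= a%:E)%E.
Proof.
move=> n0 h; have nR : 0 < n%:R :> R by rewrite ltr0n.
have E0 : 0 < E by apply: lt_le_trans h; exact: expR_gt0.
rewrite lne_EFin // -EFinM lee_fin mulN1r mulNr lerNl mulrC.
rewrite ler_pdivlMr // -ler_expR lnK ?posrE //.
by rewrite mulNr.
Qed.

(** Serves to absorb constants independent of n into the slack of the exponent. *)
Lemma near_le_expR (R : realType) (K e : R) : 0 < e ->
  \forall n \near \oo, K <= expR (n%:R * e).
Proof.
move=> e0; have := nbhs_infty_ger (K / e); apply: filterS => n.
rewrite ler_pdivrMr // => /le_trans; apply.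
by apply: le_trans (expR_ge1Dx _); rewrite lerDr.
Qed.

(** * Error bounds for tensor powers with a prior *)

Section TensorPowers.
Variables (R : realType) (d r : nat) (rho : 'I_r -> 'M[R[i]]_d) (p : 'I_r -> R).
Hypothesis rho_psd : forall i, psdmx (rho i).
Hypothesis p0 : forall i, 0 <= p i.

Let U i := spectralmx (rho i).
Let lam i a := complex.Re (spectral_diag (rho i) 0 a).
Let ov i j (x : 'I_d * 'I_d) := overlap (U i) (U j) x.1 x.2.

Definition chernoff_sum i j (s : R) : R :=
  complex.Re (\tr (mxpow (rho i) s *m mxpow (rho j) (1 - s))).

Let lam0 i a : 0 <= lam i a.
Proof. exact: (psdmx_spectral (rho_psd i)).2. Qed.

Let uU i : U i \is unitarymx.
Proof. exact: spectral_unitarymx. Qed.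

Lemma chernoff_sumE i j s : chernoff_sum i j s =
  \sum_(x : 'I_d * 'I_d)
    supp_pow s (lam i x.1) * supp_pow (1 - s) (lam j x.2) * ov i j x.
Proof. by rewrite /chernoff_sum !mxpow_udiag mxtrace_udiag_udiag pair_big. Qed.

Lemma chernoff_sum_ge0 i j s : 0 <= chernoff_sum i j s.
Proof.
rewrite chernoff_sumE; apply: sumr_ge0 => x _.
by rewrite !mulr_ge0 ?supp_pow_ge0 // overlap_ge0.
Qed.

Let error k := opt_error (fun i => (p i)%:C *: ntensmx (rho i) k.+1).

Let eig i k a := p i * ntens_eig (lam i) (k := k) a.

Let errorE k :
  error k = opt_error (fun i => udiag (ntensmx_rec (U i) k) (@eig i k)).
Proof.
congr opt_error; apply/funext => i; rewrite -udiagZ -ntens_udiag.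
by congr (_ *: ntensmx_rec _ k); exact: (psdmx_spectral (rho_psd i)).1.
Qed.

Let eig0 k i a : 0 <= @eig i k a.
Proof. by apply: mulr_ge0; [exact: p0 | apply: ntens_eig_ge0; exact: lam0]. Qed.

Let uUk k i : ntensmx_rec (U i) k \is unitarymx.
Proof. exact: ntens_unitarymx. Qed.

Lemma ntens_error_upper (i0 : 'I_r) k (s : 'I_r -> 'I_r -> R) :
  (forall i, p i <= 1) -> (forall i j, 0 <= s i j <= 1) ->
  error k <= 4 * \sum_i \sum_(j | j != i) chernoff_sum i j (s i j) ^+ k.+1.
Proof.
move=> p1 s01; rewrite errorE.
apply: le_trans (opt_error_upper (uUk k) (@eig0 k) i0) _.
apply: ler_wpM2l; first exact: ler0n.
apply: ler_sum => i _; apply: ler_sum => j _.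
rewrite (ntens_sum _ _ _ _ _ (fun x y z => Num.min (p i * x) (p j * y) * z)).
rewrite chernoff_sumE -wsum_prod; apply: ler_wsum => w _.
rewrite !big_split /= -!supp_pow_prod; [|by move=> x; exact: lam0 ..].
apply: ler_wpM2r; first by apply: prodr_ge0 => x _; exact: overlap_ge0.
have a0 : 0 <= \prod_(x <- w) lam i x.1 by apply: prodr_ge0 => x _; exact: lam0.
have b0 : 0 <= \prod_(x <- w) lam j x.2 by apply: prodr_ge0 => x _; exact: lam0.
apply: le_trans (min_le_supp_pow (s01 i j) a0 b0).
by rewrite le_min !ge_min !ler_piMl ?orbT.
Qed.

(** The smaller prior weight can be pulled out of min(p_i x, p_j y). *)
Lemma ntens_error_lower i j k : i != j ->
  Num.min (p i) (p j) * wsum k.+1 (fun w =>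
    Num.min (\prod_(x <- w) lam i x.1) (\prod_(x <- w) lam j x.2) *
    \prod_(x <- w) ov i j x) <= 2 * error k.
Proof.
move=> ij; rewrite errorE.
apply: le_trans (opt_error_lower (uUk k) (@eig0 k) ij).
rewrite (ntens_sum _ _ _ _ _ (fun x y z => Num.min (p i * x) (p j * y) * z)).
rewrite -wsumZ; apply: ler_wsum => w _; rewrite mulrA.
apply: ler_wpM2r; first by apply: prodr_ge0 => x _; exact: overlap_ge0.
have a0 : 0 <= \prod_(x <- w) lam i x.1 by apply: prodr_ge0 => x _; exact: lam0.
have b0 : 0 <= \prod_(x <- w) lam j x.2 by apply: prodr_ge0 => x _; exact: lam0.
have m0 : 0 <= Num.min (p i) (p j) by rewrite le_min !p0.
rewrite le_min; apply/andP; split; apply: ler_pM => //.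
- by rewrite le_min a0.
- by rewrite ge_min lexx.
- by rewrite ge_min lexx.
- by rewrite le_min a0.
- by rewrite ge_min lexx orbT.
- by rewrite ge_min lexx orbT.
Qed.

Lemma ntens_error_tilt i j : i != j ->
  exists2 s : R, 0 <= s <= 1 & 0 < chernoff_sum i j s ->
  exists V : R, forall k e, 0 < e ->
    Num.min (p i) (p j) * (chernoff_sum i j s ^+ k.+1 *
      expR (- (k.+1%:R * e)) * (1 - V / (k.+1%:R * e ^+ 2))) <= 2 * error k.
Proof.
move=> ij; have [s s01 H] := @chernoff_tilt R _ (fun x : 'I_d * 'I_d => lam i x.1)
  (fun x => lam j x.2) (ov i j) (fun x => lam0 i x.1) (fun x => lam0 j x.2)
  (fun x => overlap_ge0 (U i) (U j) x.1 x.2).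
exists s => //; rewrite chernoff_sumE => /H[V HV]; exists V => k e e0.
apply: le_trans (ntens_error_lower k ij); apply: ler_wpM2l; first by rewrite le_min !p0.
exact: HV.
Qed.

End TensorPowers.

Theorem theorem1 (R : realType) (d r : nat) (rho : 'I_r -> 'M[R[i]]_d)
    (p : 'I_r -> R)
    (rho_density : forall i, density_matrix (rho i))
    (p_gt0 : forall i, 0 < p i) (p_sum1 : \sum_(i < r) p i = 1) :
  (fun n : nat =>
     ((- 1 / n%:R)%:E *
      lne (opt_error (fun i => (p i)%:C *: ntensmx (rho i) n))%:E)%E) @ \oo
    --> multiple_chernoff_dist rho.
Proof.
have psd i : psdmx (rho i) by exact: (rho_density i).1.
have p0 i : 0 <= p i by exact: ltW.
have p1 i : p i <= 1.
  by rewrite -p_sum1 (bigD1 i) //= lerDl; apply: sumr_ge0 => j _; exact: p0.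
(* The prior sums to 1, so r is positive. *)
have i0 : 'I_r.
  case: r rho p rho_density p_gt0 p_sum1 {psd p0 p1} => [|r'] ? ? ? ? ps; last exact: ord0.
  by move: ps; rewrite big_ord0 => /esym/eqP; rewrite oner_eq0.
apply: cvge_slack => c e e0.
- move=> /bigmin_gtP[_ cM].
  (* As c is below the distance, each pair has an s whose trace is at most exp(-c); on the diagonal
     0 is a default value. *)
  have ex i j : exists s, 0 <= s <= 1 /\
      (j != i -> chernoff_sum rho i j s <= expR (- c)).
    have [ij|ij] := eqVneq j i; first by exists 0; rewrite lexx ler01.
    have /ereal_sup_gt[_ [s s01 <-] cs] := cM (i, j) (etrans (congr1 negb (eq_sym _ _)) ij).
    exists s; split=> // _; rewrite /chernoff_sum leNgt; apply/negP => h.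
    move: cs; rewrite lne_EFin; last by apply: lt_trans h; exact: expR_gt0.
    rewrite -EFinN lte_fin ltrNr => cs.
    move: (h); rewrite -[ltRHS]lnK ?ltr_expR; first by move/(lt_trans cs); rewrite ltxx.
    by rewrite posrE; apply: lt_trans h; exact: expR_gt0.
  pose s i j := sval (cid (ex i j)).
  have hs i j : 0 <= s i j <= 1 /\ (j != i -> chernoff_sum rho i j (s i j) <= expR (- c)).
    exact: svalP (cid (ex i j)).
  (* Four times the number of ordered pairs; exp(n e) outgrows it. *)
  pose K : R := 4 * \sum_(i < r) \sum_(j < r | j != i) 1.
  near=> n; have n0 : (0 < n)%N by near: n; exact: nbhs_infty_gt.
  have Kn : K <= expR (n%:R * e) by near: n; exact: near_le_expR.
  apply: exponent_ge => //.
  have [k En] : exists k, n = k.+1 by exists n.-1; rewrite prednK.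
  rewrite En in Kn *.
  apply: le_trans (ntens_error_upper psd p0 i0 k p1 (fun i j => (hs i j).1)) _.
  have -> : expR (- ((c - e) * k.+1%:R)) = expR (k.+1%:R * e) * expR (- c) ^+ k.+1.
    by rewrite -expRM_natr -expRD; congr expR; ring.
  apply: le_trans (_ : _ <= K * expR (- c) ^+ k.+1) _; last first.
    by apply: ler_wpM2r => //; rewrite exprn_ge0 // expR_ge0.
  rewrite -mulrA mulr_suml; apply: ler_wpM2l; first exact: ler0n.
  apply: ler_sum => i _; rewrite mulr_suml; apply: ler_sum => j ji; rewrite mul1r.
  apply: lerXn2r; rewrite ?nnegrE ?expR_ge0 ?chernoff_sum_ge0 //.
  exact: (hs i j).2.
(* Conversely, if c exceeds the distance, a single pair with Chernoff distance below c suffices. *)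
- move=> /bigmin_ltP[|[[i j] /= ij Mc]]; first by rewrite ltNge leey.
  have [s s01 tilt] := ntens_error_tilt psd p0 ij.
  set Z := chernoff_sum rho i j s in tilt.
  have cZ : (- lne Z%:E < c%:E)%E.
    by apply: le_lt_trans Mc; apply: ereal_sup_ubound; exists s.
  (* A vanishing trace would give the value +oo, which is not below c. *)
  have Z0 : 0 < Z.
    by rewrite ltNge; apply/negP => Z0; move: cZ; rewrite le0_lneNy ?lee_fin.
  have {cZ} Zc : expR (- c) <= Z.
    move: cZ; rewrite lne_EFin // -EFinN lte_fin ltrNl => /ltW.
    by rewrite -[X in _ -> _ <= X]lnK ?posrE // ler_expR.
  have [V {tilt} tilt] := tilt Z0.
  (* One half of e pays for the tilting loss exp(-n e'), the other half for the constant 4 / q: a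
     factor 2 from the two-outcome bound and a factor 2 from the Chebyshev term, which is at least
     1/2 once n >= 2 V / e'^2. *)
  pose q := Num.min (p i) (p j); pose e' := e / 2.
  have q0 : 0 < q by rewrite lt_min !p_gt0.
  have e'0 : 0 < e' by rewrite divr_gt0.
  near=> n; have n0 : (0 < n)%N by near: n; exact: nbhs_infty_gt.
  have Kn : 4 / q <= expR (n%:R * e') by near: n; exact: near_le_expR.
  have Vn : 2 * V / e' ^+ 2 <= n%:R by near: n; exact: nbhs_infty_ger.
  apply: exponent_le => //.
  have [k En] : exists k, n = k.+1 by exists n.-1; rewrite prednK.
  rewrite En in Kn Vn *.
  have := tilt k e' e'0; rewrite -/q; set err := opt_error _ => h.
  have half : 2^-1 <= 1 - V / (k.+1%:R * e' ^+ 2).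
    move: Vn; rewrite ler_pdivrMr ?exprn_gt0 // => Vn.
    have : V / (k.+1%:R * e' ^+ 2) <= 2^-1.
      by rewrite ler_pdivrMr ?mulr_gt0 ?exprn_gt0 //; lra.
    by move: (V / _) => t; lra.
  have Zn : expR (- c) ^+ k.+1 <= Z ^+ k.+1.
    by apply: lerXn2r; rewrite ?nnegrE ?expR_ge0 // ltW.
  set x := expR (k.+1%:R * e') in Kn; have x0 : 0 < x by exact: expR_gt0.
  set y := expR (- c) ^+ k.+1 in Zn; have y0 : 0 < y by rewrite exprn_gt0 ?expR_gt0.
  have -> : expR (- ((c + e) * k.+1%:R)) = y * (x^-1 * x^-1).
    rewrite /y -expRM_natr /x -expRN -!expRD; congr expR.
    by rewrite /e'; field.
  rewrite -(ler_pM2l (ltr0Sn _ 1)); apply: le_trans h.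
  rewrite expRN -/x.
  apply: le_trans (_ : _ <= q * (y * x^-1 * 2^-1)) _; last first.
    apply: ler_wpM2l; first exact: ltW.
    apply: ler_pM => //; first by rewrite mulr_ge0 ?invr_ge0 ?(ltW y0) ?(ltW x0).
    by apply: ler_wpM2r; rewrite // invr_ge0 ltW.
  have xq : x^-1 <= q / 4.
    by rewrite -[q / 4]invrK invf_div lef_pV2 ?posrE ?divr_gt0.
  have yx : 0 < y * x^-1 by rewrite mulr_gt0 ?invr_gt0.
  have := ler_wpM2l (ltW yx) xq; rewrite -mulrA.
  by move: (y * x^-1) x^-1 => t z; lra.
Unshelve. all: by end_near. Qed.
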